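(* Let $F$ be a free group and let $R,S,T$ be normal subgroups of $F$ such that $R\subseteq S$ and $R\subseteq T$. If $$a\in D(F,\ \mathbf{s}\mathbf{r}\mathbf{t}+\mathbf{t}\mathbf{r}\mathbf{s}),$$ then $$a^2\in D(F,\ \mathbf{r}\mathbf{r}\mathbf{s}+\mathbf{s}\mathbf{r}\mathbf{r}+\mathbf{t}\mathbf{r}\mathbf{r}+\mathbf{r}\mathbf{r}\mathbf{t}).$$
   Context: For a normal subgroup $R$ of the free group $F$, $\mathbf{r}=\Delta(R)\mathbb{Z}[F]=(R-1)\mathbb{Z}[F]$ is the two-sided ideal of the integral group ring $\mathbb{Z}[F]$ generated by the augmentation ideal $\Delta(R)$ of $\mathbb{Z}[R]$; similarly $\mathbf{s}$, $\mathbf{t}$ for $S$, $T$. Juxtaposition denotes products of ideals. For a two-sided ideal $\mathfrak{a}$ of $\mathbb{Z}[F]$, $D(F,\mathfrak{a})=F\cap(1+\mathfrak{a})=\{g\in F: g-1\in\mathfrak{a}\}$. *)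

(* Defs.v *)
From HB Require Import structures.
From mathcomp Require Import all_boot all_fingroup all_algebra.
From mathcomp Require Import finmap.
From mathcomp Require Import boolp classical_sets.
From mathcomp.multinomials Require Import monalg.

Set Implicit Arguments.
Unset Strict Implicit.
Unset Printing Implicit Defensive.

Import GRing.Theory.

Local Open Scope classical_set_scope.
Local Open Scope ring_scope.

(* [B] is a free basis of [F]: the universal property of the free group on [B].
   The values of [f] outside [B] are irrelevant. *)
Definition free_on (F : groupType) (B : set F) : Prop :=
  forall (G : groupType) (f : F -> G),
    exists! phi : F -> G,
      {morph phi : x y / (x * y)%g} /\ (forall b, B b -> phi b = f b).

Definition free_group (F : groupType) : Prop :=
  exists B : set F, free_on B.

Definition normal_subgroup (G : groupType) (H : set G) : Prop :=
  [/\ H 1%g,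
      forall x y, H x -> H y -> H (x * y)%g,
      forall x, H x -> H (x^-1)%g
    & forall x g, H x -> H (x ^ g)%g].

(* The integral group ring: finitely supported functions G -> int with the
   convolution product. The ring structure of [monalg] cannot be reused, as it
   is limited to monoids of monomials, in which x * y = 1 forces x = y = 1. *)
Definition groupring (G : groupType) : Type := {malg int[G]}.

HB.instance Definition _ (G : groupType) :=
  GRing.Zmodule.copy (groupring G) {malg int[G]}.

Notation "'Z[' G ]" := (groupring G)
  (at level 0, G at level 200, format "'Z[' G ]") : type_scope.

Section GroupRing.
Variable G : groupType.
Implicit Types (x y z : {malg int[G]}) (g h : G).

Definition gr_mul x y : {malg int[G]} :=
  \sum_(g <- msupp x) \sum_(h <- msupp y)
    mkmalgU (g * h)%g (mcoeff g x * mcoeff h y).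

Definition gr_one : {malg int[G]} := mkmalgU 1%g 1.

Lemma gr_mulEw (d1 d2 : {fset G}) x y :
    (msupp x `<=` d1)%fset -> (msupp y `<=` d2)%fset ->
  gr_mul x y = \sum_(g <- d1) \sum_(h <- d2)
    mkmalgU (g * h)%g (mcoeff g x * mcoeff h y).
Proof.
move=> le1 le2; rewrite /gr_mul (big_fset_incl _ le1) /=.
  apply/eq_bigr=> g _; apply/big_fset_incl => // h _ /mcoeff_outdom ->.
  by rewrite mulr0 monalgU0.
move=> g _ /mcoeff_outdom xg.
by rewrite big1 // => h _; rewrite xg mul0r monalgU0.
Qed.

Lemma gr_mulDl : left_distributive gr_mul +%R.
Proof.
move=> x y z.
rewrite (gr_mulEw (msuppD_le x y) (fsubset_refl _)).
rewrite (gr_mulEw (fsubsetUl (msupp x) (msupp y)) (fsubset_refl (msupp z))).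
rewrite (gr_mulEw (fsubsetUr (msupp x) (msupp y)) (fsubset_refl (msupp z))).
rewrite -big_split /=; apply/eq_bigr=> g _.
rewrite -big_split /=; apply/eq_bigr=> h _.
by rewrite mcoeffD mulrDl monalgUD.
Qed.

Lemma gr_mulDr : right_distributive gr_mul +%R.
Proof.
move=> z x y.
rewrite (gr_mulEw (fsubset_refl _) (msuppD_le x y)).
rewrite (gr_mulEw (fsubset_refl (msupp z)) (fsubsetUl (msupp x) (msupp y))).
rewrite (gr_mulEw (fsubset_refl (msupp z)) (fsubsetUr (msupp x) (msupp y))).
rewrite -big_split /=; apply/eq_bigr=> g _.
rewrite -big_split /=; apply/eq_bigr=> h _.
by rewrite mcoeffD mulrDr monalgUD.
Qed.

Lemma gr_mulUU g h (a b : int) :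
  gr_mul (mkmalgU g a) (mkmalgU h b) = mkmalgU (g * h)%g (a * b).
Proof. by rewrite (gr_mulEw msuppU_le msuppU_le) !big_seq_fset1 !mcoeffUU. Qed.

Lemma gr_mul0r : left_zero 0 gr_mul.
Proof. by move=> x; apply/(addrI (gr_mul 0 x)); rewrite -gr_mulDl !addr0. Qed.

Lemma gr_mulr0 : right_zero 0 gr_mul.
Proof. by move=> x; apply/(addrI (gr_mul x 0)); rewrite -gr_mulDr !addr0. Qed.

Lemma gr_mul_suml (I : Type) (r : seq I) (E : I -> {malg int[G]}) y :
  gr_mul (\sum_(i <- r) E i) y = \sum_(i <- r) gr_mul (E i) y.
Proof.
by rewrite (big_morph (gr_mul^~ y) (fun _ _ => gr_mulDl _ _ _) (gr_mul0r _)).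
Qed.

Lemma gr_mul_sumr (I : Type) (r : seq I) (E : I -> {malg int[G]}) x :
  gr_mul x (\sum_(i <- r) E i) = \sum_(i <- r) gr_mul x (E i).
Proof.
by rewrite (big_morph (gr_mul x) (fun _ _ => gr_mulDr _ _ _) (gr_mulr0 _)).
Qed.

Lemma gr_mulA : associative gr_mul.
Proof.
move=> x y z; rewrite [x]monalgE !gr_mul_suml; apply: eq_bigr => g _.
rewrite [y]monalgE !(gr_mul_suml, gr_mul_sumr); apply: eq_bigr => h _.
rewrite [z]monalgE !gr_mul_sumr; apply: eq_bigr => k _.
by rewrite !gr_mulUU mulrA mulgA.
Qed.

Lemma gr_mul1r : left_id gr_one gr_mul.
Proof.
move=> x; rewrite [x in LHS]monalgE gr_mul_sumr [RHS]monalgE.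
by apply: eq_bigr => g _; rewrite gr_mulUU mul1r mul1g.
Qed.

Lemma gr_mulr1 : right_id gr_one gr_mul.
Proof.
move=> x; rewrite [x in LHS]monalgE gr_mul_suml [RHS]monalgE.
by apply: eq_bigr => g _; rewrite gr_mulUU mulr1 mulg1.
Qed.

Lemma gr_one_neq0 : gr_one != 0.
Proof. by apply/eqP => /malgP /(_ 1%g); rewrite mcoeffUU mcoeff0. Qed.

HB.instance Definition _ := GRing.Zmodule_isNzRing.Build (groupring G)
  gr_mulA gr_mul1r gr_mulr1 gr_mulDl gr_mulDr gr_one_neq0.

Definition gr_of (g : G) : Z[G] := mkmalgU g 1.

Lemma gr_of1 : gr_of 1%g = 1.
Proof. by []. Qed.

Lemma gr_ofM g h : gr_of (g * h)%g = gr_of g * gr_of h.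
Proof. by rewrite [RHS]gr_mulUU mulr1. Qed.

Definition augmentation (x : Z[G]) : int := \sum_(g <- msupp x) mcoeff g x.

End GroupRing.

(* The augmentation ideal of Z[H], viewed inside Z[G]: elements supported in H
   whose coefficients sum to 0. *)
Definition Delta (G : groupType) (H : set G) : set Z[G] :=
  [set x | (forall g, g \in msupp x -> H g) /\ augmentation x = 0].

(* The product is the additive group of finite sums of products i * j. No signs
   are needed, as it is only applied when I is closed under opposite. *)
Definition ideal_mul (A : pzRingType) (I J : set A) : set A :=
  [set x | exists s : seq (A * A),
     (forall p, p \in s -> I p.1 /\ J p.2) /\ x = \sum_(p <- s) p.1 * p.2].

Definition ideal_add (A : pzRingType) (I J : set A) : set A :=
  [set i + j | i in I & j in J].

Declare Scope ideal_scope.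
Delimit Scope ideal_scope with I.
Notation "I * J" := (ideal_mul I J) : ideal_scope.
Notation "I + J" := (ideal_add I J) : ideal_scope.

Definition rel_ideal (G : groupType) (H : set G) : set Z[G] :=
  ideal_mul (Delta H) [set: Z[G]].

Definition D (G : groupType) (I : set Z[G]) : set G :=
  [set g | I (gr_of g - 1)].

(* Main.v *)
(* Let U = ST, J the target ideal and rr the square of r.  Since every element
   of U acts trivially on rr on both sides modulo J, the map x - 1 |-> x - x^-1
   on R extends to an additive map L on Z[F], vanishing off Z[U], with
     L (w (x - 1) v) = w x w^-1 - v^-1 x^-1 v   modulo J
   for x in R and w, v in U.  The right-hand side is a function of w plus a
   function of v, so L maps every (w - 1)(x - 1)(v - 1) g, and hence all of
   srt + trs, into J.  An element a with a - 1 in srt + trs lies in R, and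
   L (a - 1) = a - a^-1 = a^-1 (a^2 - 1) modulo J. *)
Require Import Defs.
From mathcomp Require Import all_boot all_fingroup all_algebra.
From mathcomp Require Import finmap.
From mathcomp Require Import boolp classical_sets.
From mathcomp.multinomials Require Import monalg.
From mathcomp Require Import ring.

Set Implicit Arguments.
Unset Strict Implicit.
Unset Printing Implicit Defensive.

Import GRing.Theory.

Local Open Scope classical_set_scope.
Local Open Scope ring_scope.

(** * Additive subgroups and their closure properties *)

Definition additive_subgroup (V : zmodType) (P : set V) : Prop :=
  P 0 /\ forall x y, P x -> P y -> P (x - y).

Section AdditiveSubgroup.
Variables (V : zmodType) (P : set V).
Hypothesis P_sub : additive_subgroup P.

Lemma subgroupN x : P x -> P (- x).
Proof. by move=> Px; rewrite -sub0r; apply: P_sub.2 => //; exact: P_sub.1. Qed.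

Lemma subgroupD x y : P x -> P y -> P (x + y).
Proof. by move=> Px Py; rewrite -[y]opprK; apply/P_sub.2/subgroupN. Qed.

Lemma subgroup_sum (I : eqType) (l : seq I) (E : I -> V) :
  (forall i, i \in l -> P (E i)) -> P (\sum_(i <- l) E i).
Proof.
move=> PE; rewrite big_seq; elim/big_ind: _ => //; first exact: P_sub.1.
exact: subgroupD.
Qed.

Lemma subgroupMz x (n : int) : P x -> P (x *~ n).
Proof.
move=> Px; suff PxM k : P (x *+ k) 
    by case: n => k; rewrite ?NegzE ?mulrNz; [|apply: subgroupN]; exact: PxM.
by elim: k => [|k IHk]; rewrite ?mulr0n ?mulrS; [exact: P_sub.1|exact: subgroupD].
Qed.

End AdditiveSubgroup.

Lemma additive_subgroup_preim (V W : zmodType) (f : V -> W) (P : set W) :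
  f 0 = 0 -> {morph f : x y / x - y} ->
  additive_subgroup P -> additive_subgroup [set x | P (f x)].
Proof.
by move=> f0 fB [P0 PB]; split=> /= [|x y Px Py]; rewrite ?f0 ?fB //; exact: PB.
Qed.

Lemma additive_subgroup0 (V : zmodType) : additive_subgroup [set (0 : V)].
Proof. by split=> // x y /= -> ->; rewrite subr0. Qed.

(** * Sums and products of ideals *)

Section IdealMul.
Variable A : pzRingType.
Implicit Types I J P : set A.

Lemma ideal_mul_mem I J x y : I x -> J y -> ideal_mul I J (x * y).
Proof.
move=> Ix Jy; exists [:: (x, y)]; split; last by rewrite big_seq1.
by move=> p; rewrite inE => /eqP ->.
Qed.

Lemma ideal_mul_ind I J P :
  additive_subgroup P -> (forall x y, I x -> J y -> P (x * y)) ->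
  forall x, ideal_mul I J x -> P x.
Proof.
by move=> P_sub IJ x [l [lIJ ->]]; apply: subgroup_sum => // p /lIJ[]; apply: IJ.
Qed.

Lemma ideal_mul_subgroup I J :
  (forall x, I x -> I (- x)) -> additive_subgroup (ideal_mul I J).
Proof.
move=> IN; split=> [|_ _ [l [lIJ ->]] [l' [l'IJ ->]]].
  by exists [::]; rewrite big_nil.
exists (l ++ [seq (- p.1, p.2) | p <- l']); split.
  move=> p; rewrite mem_cat => /orP[/lIJ //|/mapP[p' /l'IJ[Ip' Jp'] ->]].
  by split=> //=; exact: IN.
(* The signs of the subtracted sum go into its left factors, where [I] is closed under opposite. *)
rewrite big_cat big_map /= -sumrN; congr (_ + _).
by apply: eq_bigr => p _; rewrite mulNr.
Qed.

Lemma ideal_add_subgroup I J :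
  additive_subgroup I -> additive_subgroup J ->
  additive_subgroup (ideal_add I J).
Proof.
move=> [I0 IB] [J0 JB]; split; first by exists 0 => //; exists 0; rewrite ?addr0.
move=> _ _ [i Ii [j Jj <-]] [i' Ii' [j' Jj' <-]].
by exists (i - i'); [exact: IB|exists (j - j'); [exact: JB|rewrite opprD addrACA]].
Qed.

Lemma ideal_addl I J x : additive_subgroup J -> I x -> ideal_add I J x.
Proof. by move=> [J0 _] Ix; exists x => //; exists 0; rewrite ?addr0. Qed.

Lemma ideal_addr I J x : additive_subgroup I -> J x -> ideal_add I J x.
Proof. by move=> [I0 _] Jx; exists 0 => //; exists x; rewrite ?add0r. Qed.

Definition left_ideal I := additive_subgroup I /\ forall c x, I x -> I (c * x).

Lemma ideal_mul_left I J : left_ideal I -> left_ideal (ideal_mul I J).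
Proof.
move=> [I_sub IM]; have IJ_sub : additive_subgroup (ideal_mul I J).
  by apply: ideal_mul_subgroup => x; exact: (subgroupN I_sub).
split=> // c; apply: ideal_mul_ind.
  exact: (additive_subgroup_preim (mulr0 c) (mulrBr c) IJ_sub).
by move=> x y Ix Jy; rewrite mulrA; apply: ideal_mul_mem => //; exact: IM.
Qed.

Lemma ideal_add_left I J :
  left_ideal I -> left_ideal J -> left_ideal (ideal_add I J).
Proof.
move=> [I_sub IM] [J_sub JM]; split; first exact: ideal_add_subgroup.
move=> c _ [i Ii [j Jj <-]]; exists (c * i); first exact: IM.
by exists (c * j); [exact: JM|rewrite mulrDr].
Qed.

End IdealMul.

(** * Additive maps on the group ring given by their values on group elements *)

Section LinearExtension.
Variables (G : groupType) (V : zmodType) (f : G -> V).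

Definition lin_ext (x : Z[G]) : V := \sum_(g <- msupp x) f g *~ mcoeff g x.

Lemma lin_extEw (d : {fset G}) (x : Z[G]) : (msupp x `<=` d)%fset ->
  lin_ext x = \sum_(g <- d) f g *~ mcoeff g x.
Proof.
move=> xd; rewrite /lin_ext (big_fset_incl _ xd) //= => g _ /mcoeff_outdom ->.
by rewrite mulr0z.
Qed.

Lemma lin_ext0 : lin_ext 0 = 0.
Proof. by rewrite /lin_ext msupp0 big_seq_fset0. Qed.

Lemma lin_extB : {morph lin_ext : x y / x - y}.
Proof.
move=> x y; rewrite (lin_extEw (msuppB_le x y)).
rewrite (lin_extEw (fsubsetUl (msupp x) (msupp y))).
rewrite (lin_extEw (fsubsetUr (msupp x) (msupp y))).
by rewrite -sumrB; apply: eq_bigr => g _; rewrite mcoeffB mulrzBr.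
Qed.

Lemma lin_ext_gr g : lin_ext (gr_of g) = f g.
Proof. by rewrite (lin_extEw msuppU_le) big_seq_fset1 mcoeffUU. Qed.

End LinearExtension.

(** * Generators of relative ideals and of their products *)

Section RelativeIdeals.
Variable G : groupType.
Implicit Types (H : set G) (P : set Z[G]).

Lemma gr_of_inj : injective (@gr_of G).
Proof.
move=> g h /malgP /(_ g); rewrite !mcoeffU eqxx /=.
by case: eqP => // ->.
Qed.

Lemma malg_gr_sum (x : Z[G]) : x = \sum_(g <- msupp x) gr_of g *~ mcoeff g x.
Proof.
rewrite [LHS]monalgE; apply: eq_bigr => g _; apply/malgP => h.
by rewrite raddfMz /= !mcoeffU; case: eqP => _; rewrite ?mul0rz //= intz.
Qed.

Lemma gr_ind P :
  additive_subgroup P -> (forall g, P (gr_of g)) -> forall x, P x.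
Proof.
move=> P_sub Pg x; rewrite [x]malg_gr_sum; apply: subgroup_sum => // g _.
exact: subgroupMz.
Qed.

Lemma augmentationE (x : Z[G]) : augmentation x = lin_ext (fun=> 1 : int) x.
Proof. by apply: eq_bigr => g _; rewrite intz. Qed.

(** Subtracting from [x] its augmentation, which is 0, writes it as the combination of the [g - 1]
    with the coefficients of [x] itself. *)
Lemma Delta_ind H P :
  additive_subgroup P -> (forall h, H h -> P (gr_of h - 1)) ->
  forall x, Delta H x -> P x.
Proof.
move=> P_sub Ph x [xH x0].
have -> : x = \sum_(g <- msupp x) (gr_of g - 1) *~ mcoeff g x.
  transitivity (x - 1 *~ augmentation x); first by rewrite x0 mulr0z subr0.
  rewrite [X in X - _]malg_gr_sum /augmentation.
  by rewrite mulrz_sumr -sumrB; apply: eq_bigr => g _; rewrite mulrzBl.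
by apply: subgroup_sum => // g /xH Hg; apply: subgroupMz => //; exact: Ph.
Qed.

Lemma Delta_mem H h : H 1%g -> H h -> Delta H (gr_of h - 1).
Proof.
move=> H1 Hh; split; last first.
  by rewrite augmentationE lin_extB -gr_of1 !lin_ext_gr subrr.
move=> g /(fsubsetP (msuppB_le _ _)); rewrite in_fsetU.
by case/orP => /(fsubsetP msuppU_le); rewrite in_fset1 => /eqP ->.
Qed.

Lemma rel_ideal_mem H h x :
  normal_subgroup H -> H h -> rel_ideal H ((gr_of h - 1) * x).
Proof. by case=> H1 _ _ _ Hh; apply: ideal_mul_mem => //; exact: Delta_mem. Qed.

Lemma rel_ideal_ind H P :
  additive_subgroup P -> (forall h g, H h -> P ((gr_of h - 1) * gr_of g)) ->
  forall x, rel_ideal H x -> P x.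
Proof.
move=> P_sub Phg; apply: ideal_mul_ind => // x y Hx _; move: x Hx.
apply: Delta_ind => [|h Hh].
  exact: (additive_subgroup_preim (mul0r y) (fun u v => mulrBl y u v) P_sub).
move: y; apply: gr_ind => [|g]; last exact: Phg.
exact: (additive_subgroup_preim (mulr0 _) (mulrBr _) P_sub).
Qed.

(** Conjugation carries [g] across [h - 1]; with [H] normal this makes [rel_ideal H], a right ideal
    by construction, a left ideal too. *)
Lemma gr_conjM g h (x : Z[G]) :
  gr_of g * ((gr_of h - 1) * x) = (gr_of (h ^ g^-1)%g - 1) * (gr_of g * x).
Proof.
rewrite !mulrA; congr (_ * x).
by rewrite mulrBr mulrBl mulr1 mul1r -!gr_ofM conjgE invgK !mulgA mulgKV.
Qed.

Lemma rel_ideal_left H : normal_subgroup H -> left_ideal (rel_ideal H).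
Proof.
move=> nH; have r_sub : additive_subgroup (rel_ideal H).
  apply: ideal_mul_subgroup => x [xH x0]; split=> [g|].
    by rewrite msuppN => /xH.
  by rewrite augmentationE -sub0r lin_extB lin_ext0 -augmentationE x0 subr0.
split=> // c x rx; move: c; apply: gr_ind => [|g].
  exact: (additive_subgroup_preim (mul0r x) (fun u v => mulrBl x u v) r_sub).
move: x rx; apply: rel_ideal_ind => [|h k Hh].
  exact: (additive_subgroup_preim (mulr0 _) (mulrBr _) r_sub).
by rewrite /= gr_conjM; apply: rel_ideal_mem => //; case: nH => _ _ _; apply.
Qed.

Lemma rel_ideal_mul_ind H I J P :
  additive_subgroup P -> left_ideal I -> left_ideal J ->
  (forall h x y, H h -> I x -> J y -> P ((gr_of h - 1) * x * y)) ->
  forall x, ideal_mul (ideal_mul (rel_ideal H) I) J x -> P x.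
Proof.
move=> P_sub [I_sub IM] [J_sub JM] PHIJ; apply: ideal_mul_ind => // x z + Jz.
move: x; apply: ideal_mul_ind => [|x y + Iy].
  exact: (additive_subgroup_preim (mul0r z) (fun u v => mulrBl z u v) P_sub).
move: x; apply: rel_ideal_ind => [|h g Hh] /=.
  split=> /= [|u v]; first by rewrite !mul0r; exact: P_sub.1.
  by rewrite !mulrBl; exact: P_sub.2.
by rewrite -(mulrA _ _ y); apply: PHIJ => //; exact: IM.
Qed.

(** The group element trailing each generator is absorbed into the next factor, a left ideal; only
    the last one, [g], survives. *)
Lemma rel_ideal_mul3_ind (A B C : set G) P :
  additive_subgroup P -> normal_subgroup B -> normal_subgroup C ->
  (forall a b c g, A a -> B b -> C c ->
    P ((gr_of a - 1) * (gr_of b - 1) * (gr_of c - 1) * gr_of g)) ->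
  forall x,
    ideal_mul (ideal_mul (rel_ideal A) (rel_ideal B)) (rel_ideal C) x -> P x.
Proof.
move=> P_sub nB nC PABC.
have [b_left c_left] := (rel_ideal_left nB, rel_ideal_left nC).
apply: rel_ideal_mul_ind => // a x y Aa Bx Cy; move: x Bx y Cy.
(* The induction predicate quantifies over [y], because [k] is then absorbed into [y]. *)
apply: rel_ideal_ind => [|b k Bb y Cy].
  split=> /= [y _|u v Pu Pv y Cy]; first by rewrite mulr0 mul0r; exact: P_sub.1.
  by rewrite mulrBr mulrBl; apply: P_sub.2; [exact: Pu|exact: Pv].
rewrite mulrA -(mulrA _ _ y); move: (_ * y) (c_left.2 (gr_of k) y Cy).
apply: rel_ideal_ind => [|c g Cc]; last by rewrite /= !mulrA; exact: PABC.
exact: (additive_subgroup_preim (mulr0 _) (mulrBr _) P_sub).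
Qed.

End RelativeIdeals.

(** * The skew map modulo [J], and the detection of [R] by cosets *)

Section Skew.
Variables (G : groupType) (R U : set G) (J : set Z[G]).
Hypothesis nR : normal_subgroup R.
Hypothesis UM : forall x y, U x -> U y -> U (x * y)%g.
Hypothesis UV : forall x, U x -> U (x^-1)%g.
Hypothesis RU : R `<=` U.
Hypothesis J_left : left_ideal J.
Hypothesis JU : forall w x y, U w -> R x -> R y ->
  J ((gr_of w - 1) * ((gr_of x - 1) * (gr_of y - 1))) /\
  J ((gr_of x - 1) * (gr_of y - 1) * (gr_of w - 1)).

(** The set is the coset [R g], and [xget] depends on that set only, so equal cosets get equal
    representatives. The default 1 is never taken: [g] lies in its own coset. *)
Definition coset_rep (g : G) : G := xget 1%g [set h | R (g * h^-1)%g].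

Lemma coset_repP g : R (g * (coset_rep g)^-1)%g.
Proof.
apply: (@xgetPex _ 1%g [set h | R (g * h^-1)%g]); exists g.
by rewrite /= mulgV; case: nR.
Qed.

Lemma coset_repM x g : R x -> coset_rep (x * g)%g = coset_rep g.
Proof.
case: nR => _ RM RV _ Rx; congr (xget _ _).
apply/seteqP; split=> h /=; rewrite -mulgA => Rh; last exact: RM.
by rewrite -(mulKg x (g * _)%g); apply: RM => //; exact: RV.
Qed.

(* [g * q^-1 - g^-1 * q], with [q] the representative of the coset [R g], stands
   for [y - q^-1 y^-1 q] where [g = y q] with [y] in [R]. *)
Definition skew_fun (g : G) : Z[G] :=
  if `[< U g >] then gr_of (g * (coset_rep g)^-1) - gr_of (g^-1 * coset_rep g)
  else 0.

(** The map L of the opening outline. *)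
Definition skew : Z[G] -> Z[G] := lin_ext skew_fun.

(* With [g = y q], [y] in [R], both sides differ by [E - (x g)^-1 E q] where
   [E = (x - 1)(y - 1)], and conjugation by [U] fixes [E] modulo [J]. *)
Lemma skewR x g : R x -> U g ->
  J (skew (gr_of (x * g)) - skew (gr_of g)
     - (gr_of x - gr_of (g^-1 * x^-1 * g))).
Proof.
move=> Rx Ug; have Uxg : U (x * g)%g by apply: UM => //; exact: RU.
rewrite /skew !lin_ext_gr /skew_fun !asboolT // coset_repM //.
set q := coset_rep g; pose y := (g * q^-1)%g.
have Ry : R y by exact: coset_repP.
(* [q = y^-1 g] with [y] in [R], hence in [U]. *)
have Uq : U q.
  rewrite -[q](mulgKV g) -[(q * _)%g]invgK invMg invgK.
  by apply: UM => //; apply/UV/RU.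
pose E := (gr_of x - 1) * (gr_of y - 1).
suff -> : gr_of (x * g * q^-1) - gr_of ((x * g)^-1 * q)
    - (gr_of (g * q^-1) - gr_of (g^-1 * q)) - (gr_of x - gr_of (g^-1 * x^-1 * g))
  = gr_of (x * g)^-1 * ((gr_of (x * g) - 1) * E - E * (gr_of q - 1)).
  apply: J_left.2; apply: J_left.1.2; last by case: (JU Uq Rx Ry).
  by case: (JU Uxg Rx Ry).
have -> : (gr_of (x * g) - 1) * E - E * (gr_of q - 1)
    = gr_of (x * g) * E - E * gr_of q.
  by rewrite mulrBl mul1r mulrBr mulr1 opprB addrA subrK.
rewrite mulrBr mulrA -gr_ofM mulVg gr_of1 mul1r.
have -> : E = gr_of (x * y) - gr_of x - gr_of y + gr_of 1%g.
  rewrite /E mulrBr mulrBl mulr1 mul1r -gr_ofM gr_of1.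
  by apply/malgP => k; rewrite !(mcoeffB, mcoeffD, mcoeffN); ring.
rewrite !(mulrDl, mulrDr, mulNr, mulrN) -!gr_ofM.
have -> : ((x * g)^-1 * (x * y * q) = 1)%g by rewrite /y -mulgA mulgKV mulVg.
have -> : ((x * g)^-1 * (x * q) = g^-1 * q)%g by rewrite invMg -mulgA mulKg.
have -> : ((x * g)^-1 * (y * q) = g^-1 * x^-1 * g)%g by rewrite /y mulgKV invMg.
rewrite /y mulgA mul1g.
by apply/malgP => k; rewrite !(mcoeffB, mcoeffD, mcoeffN); ring.
Qed.

(** This is [skewR] for [w x w^-1] and [w v]: conjugating the inverse of the first by the second
    cancels [w], which separates the two variables. *)
Lemma skew_sandwich w x v : U w -> R x -> U v ->
  J (skew (gr_of (w * x * v)) - skew (gr_of (w * v))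
     - (gr_of (w * x * w^-1) - gr_of (v^-1 * x^-1 * v))).
Proof.
move=> Uw Rx Uv; have Rwx : R (x ^ w^-1)%g by case: nR => _ _ _; apply.
have := skewR Rwx (UM Uw Uv); rewrite conjgE invgK.
rewrite !mulgA mulgKV !invMg !invgK !mulgA.
by rewrite !mulgKV.
Qed.

Lemma skew_notin g : ~ U g -> skew (gr_of g) = 0.
Proof. by move=> nUg; rewrite /skew lin_ext_gr /skew_fun asboolF. Qed.

(** Pairing the eight terms that differ by [x] leaves a mixed second difference of [d], over [w] in
    {a, 1} and [v] in {bg, g}. It kills any function of [w] plus a function of [v]. *)
Lemma lin_ext_triple (V : zmodType) (f : G -> V) a x b g :
  let d w v := lin_ext f (gr_of (w * x * v)) - lin_ext f (gr_of (w * v)) in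
  lin_ext f ((gr_of a - 1) * (gr_of x - 1) * (gr_of b - 1) * gr_of g)
  = d a (b * g)%g - d 1%g (b * g)%g - (d a g - d 1%g g).
Proof.
rewrite /= -!lin_extB; congr lin_ext.
rewrite -gr_of1 !(mulrDl, mulrDr, mulNr, mulrN) -!gr_ofM ?(mulg1, mul1g).
by apply/malgP => k; rewrite !mulgA !(mcoeffB, mcoeffD, mcoeffN); ring.
Qed.

Lemma skew_triple a x b g : U a -> R x -> U b ->
  J (skew ((gr_of a - 1) * (gr_of x - 1) * (gr_of b - 1) * gr_of g)).
Proof.
move=> Ua Rx Ub; rewrite /skew lin_ext_triple -/skew.
have U1 : U 1%g by rewrite -(mulgV a); apply: UM => //; exact: UV.
(* For [g] outside the subgroup [U], all eight group elements lie in [U g], off [U], where [skew]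
   vanishes. *)
have [Ug|nUg] := pselect (U g); last first.
  have nU w : U w -> ~ U (w * g)%g.
    by move=> Uw Uwg; apply: nUg; rewrite -(mulKg w g); apply: UM => //; exact: UV.
  have Ux : U x by exact: RU.
  rewrite -!/(skew _) !(mulgA _ b) !skew_notin ?subrr;
    by [exact: J_left.1.1|apply: nU; do ?apply: UM].
have Ubg := UM Ub Ug.
have J_sub := J_left.1.
(* In the alternating sum of the four sandwich congruences the separated terms cancel. *)
have := J_sub.2 _ _
  (J_sub.2 _ _ (skew_sandwich Ua Rx Ubg) (skew_sandwich U1 Rx Ubg))
  (J_sub.2 _ _ (skew_sandwich Ua Rx Ug) (skew_sandwich U1 Rx Ug)).
congr J; rewrite -!/(skew _).
by apply/malgP => k; rewrite !(mcoeffB, mcoeffD, mcoeffN); ring.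
Qed.

(** The linear map is the projection from Z[G] to Z[G/R], read on representatives. By normality
    [w x v] and [w v] share a coset, so the second difference is zero term by term. *)
Lemma coset_rep_triple (a x b g : G) : R x ->
  lin_ext (fun h => gr_of (coset_rep h))
    ((gr_of a - 1) * (gr_of x - 1) * (gr_of b - 1) * gr_of g) = 0.
Proof.
move=> Rx; have rep w v : coset_rep (w * x * v)%g = coset_rep (w * v)%g.
  have -> : (w * x * v = x ^ w^-1 * (w * v))%g.
    by rewrite conjgE invgK !mulgA mulgKV.
  by apply: coset_repM; case: nR => _ _ _; apply.
by rewrite lin_ext_triple !lin_ext_gr /= !rep !subrr.
Qed.

Lemma coset_rep_in a :
  lin_ext (fun h => gr_of (coset_rep h)) (gr_of a - 1) = 0 -> R a.
Proof.
rewrite lin_extB -gr_of1 !lin_ext_gr /= => /eqP; rewrite subr_eq0.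
move=> /eqP /gr_of_inj rep_a; case: nR => _ RM RV _.
have := RM _ _ (coset_repP a) (RV _ (coset_repP 1%g)).
by rewrite rep_a invMg invgK mulgA mulgKV invg1 mulg1.
Qed.

(** [skewR] at [g = 1] gives [a - a^-1] in [J]; multiplying by [a] on the left gives [a^2 - 1]. *)
Lemma skew_square a : R a -> J (skew (gr_of a - 1)) -> J (gr_of (a ^+ 2)%g - 1).
Proof.
have [J_sub JM] := J_left.
move=> Ra Ja; have U1 : U 1%g by apply: RU; case: nR.
have := J_sub.2 _ _ Ja (skewR Ra U1).
rewrite invg1 mul1g !mulg1 /skew lin_extB gr_of1 opprB addrC subrK.
by move=> /(JM (gr_of a)); rewrite mulrBr -!gr_ofM mulgV expgS expg1.
Qed.

End Skew.

(** * The product of two normal subgroups *)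

Section ProductSubgroup.
Variables (G : groupType) (S T : set G).
Hypotheses (nS : normal_subgroup S) (nT : normal_subgroup T).

Definition product_set : set G := [set (x * y)%g | x in S & y in T].

Lemma product_setM x y :
  product_set x -> product_set y -> product_set (x * y)%g.
Proof.
case: nS nT => [_ SM _ SJ] [_ TM _ _].
move=> [a Sa [b Tb <-]] [a' Sa' [b' Tb' <-]].
exists (a * a' ^ b^-1)%g; first by apply: SM => //; exact: SJ.
exists (b * b')%g; first exact: TM.
by rewrite conjgE invgK !mulgA mulgKV.
Qed.

Lemma product_setV x : product_set x -> product_set (x^-1)%g.
Proof.
case: nS nT => [_ _ SV SJ] [_ _ TV _] [a Sa [b Tb <-]].
exists (a^-1 ^ b)%g; first by apply: SJ; exact: SV.
exists (b^-1)%g; first exact: TV.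
by rewrite conjgE !mulgA mulgK invMg.
Qed.

End ProductSubgroup.

(** * Application of the skew map with [U = ST] *)

Theorem theorem5p2 (F : groupType) (R S T : set F) :
  free_group F ->
  normal_subgroup R -> normal_subgroup S -> normal_subgroup T ->
  R `<=` S -> R `<=` T ->
  let r := rel_ideal R in
  let s := rel_ideal S in
  let t := rel_ideal T in
  forall a : F,
    D (s * r * t + t * r * s)%I a ->
    D (r * r * s + s * r * r + t * r * r + r * r * t)%I (a ^+ 2)%g.
Proof.
move=> _ nR nS nT RS _ r s t a; rewrite /D /=.
set J := (_ + r * r * t)%I => Ia.
have r_left := rel_ideal_left nR.
have s_left := rel_ideal_left nS.
have t_left := rel_ideal_left nT.
have [S1 _ _ _] := nS; have [T1 _ _ _] := nT.
pose U := product_set S T.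
have UM := @product_setM _ _ _ nS nT.
have UV := @product_setV _ _ _ nS nT.
have SU : S `<=` U by move=> x Sx; exists x => //; exists 1%g; rewrite ?mulg1.
have TU : T `<=` U by move=> x Tx; exists 1%g => //; exists x; rewrite ?mul1g.
have RU : R `<=` U by move=> x /RS /SU.
have rrs_left := ideal_mul_left s (ideal_mul_left r r_left).
have srr_left := ideal_mul_left r (ideal_mul_left r s_left).
have trr_left := ideal_mul_left r (ideal_mul_left r t_left).
have rrt_left := ideal_mul_left t (ideal_mul_left r r_left).
have J1_left := ideal_add_left rrs_left srr_left.
have J2_left := ideal_add_left J1_left trr_left.
have J_left : left_ideal J by exact: ideal_add_left J2_left rrt_left.
have JU w x y : U w -> R x -> R y ->
    J ((gr_of w - 1) * ((gr_of x - 1) * (gr_of y - 1))) /\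
    J ((gr_of x - 1) * (gr_of y - 1) * (gr_of w - 1)).
  have gen H h : normal_subgroup H -> H h -> rel_ideal H (gr_of h - 1).
    by move=> nH Hh; rewrite -[_ - 1]mulr1; exact: rel_ideal_mem.
  move=> [b Sb [c Tc <-]] Rx Ry.
  have [rx ry] : r (gr_of x - 1) /\ r (gr_of y - 1) by split; exact: gen.
  (* This splits [w - 1] into an [S] part and a [T] part. On the left of [rr] they land in [srr] and
     [trr], on the right in [rrs] and [rrt]: the four summands of [J]. *)
  have -> : gr_of (b * c)%g - 1 = (gr_of b - 1) * gr_of c + (gr_of c - 1).
    by rewrite mulrBl mul1r -gr_ofM addrA subrK.
  split.
    rewrite mulrDl -[in X in X + _]mulrA; apply: (subgroupD J_left.1).
      apply: ideal_addl rrt_left.1 _; apply: ideal_addl trr_left.1 _.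
      apply: ideal_addr rrs_left.1 _; rewrite !mulrA.
      apply: ideal_mul_mem ry; rewrite -mulrA.
      (* The stray [c] is absorbed into [r], a left ideal. *)
      by apply: ideal_mul_mem; [exact: gen|exact: r_left.2].
    apply: ideal_addl rrt_left.1 _; apply: ideal_addr J1_left.1 _.
    by rewrite mulrA; apply: ideal_mul_mem ry; apply: ideal_mul_mem rx; exact: gen.
  rewrite mulrDr; apply: (subgroupD J_left.1).
    apply: ideal_addl rrt_left.1 _; apply: ideal_addl trr_left.1 _.
    apply: ideal_addl srr_left.1 _; apply: ideal_mul_mem (rel_ideal_mem _ nS Sb).
    exact: ideal_mul_mem.
  apply: ideal_addr J2_left.1 _; apply: ideal_mul_mem; last exact: gen.
  exact: ideal_mul_mem.
(* Since [S] and [T] both lie in [U], the summands [srt] and [trs] have generators of one common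
   shape. *)
have generators_a P : additive_subgroup P ->
    (forall b x c g, U b -> R x -> U c ->
      P ((gr_of b - 1) * (gr_of x - 1) * (gr_of c - 1) * gr_of g)) ->
    P (gr_of a - 1).
  move=> P_sub PU; case: Ia => y sy [z tz <-].
  apply: (subgroupD P_sub).
    by move: y sy; apply: rel_ideal_mul3_ind => // b x c g /SU ? ? /TU ?; exact: PU.
  by move: z tz; apply: rel_ideal_mul3_ind => // b x c g /TU ? ? /SU ?; exact: PU.
(* The projection to cosets kills all these generators, hence [a - 1], so [a] and 1 share a coset of
   [R]. *)
have Ra : R a.
  apply: (coset_rep_in nR).
  apply: (generators_a [set x | lin_ext _ x = 0]) => [|b x c g _ Rx _].
    exact: (additive_subgroup_preim (lin_ext0 _) (lin_extB _) (additive_subgroup0 _)).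
  exact: coset_rep_triple.
apply: (skew_square nR UM UV RU J_left JU) => //.
apply: (generators_a [set x | J (skew R U x)]) => [|b x c g Ub Rx Uc].
  exact: (additive_subgroup_preim (lin_ext0 _) (lin_extB _) J_left.1).
exact: (skew_triple nR UM UV RU J_left JU).
Qed.
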